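(* For any integers $\ell,m,n\in\mathbb{N}_{>0}$ and any Mealy machine $T=(S,s_0,\Sigma=\{0,1\}^{\ell},\Lambda\subseteq\{0,1\}^m,t,o)$, the transcription function $\tau_{T,n}$ can be implemented by a hazard-free circuit of size $$O\left(\left(2^{3|S|}+2^{2|S|+\ell}/\ell+2^{\ell}\lambda\right)n\right)$$ and depth $$O\left(|S|\log n+\ell\right),$$ where $\lambda:=\min\{m,2^{|S|\cdot|\Sigma|}\}$. (The constants hidden in the $O$-notation are absolute.)
   Context: Ternary logic. Let $\mathbb{B}=\{0,1\}$ and $\mathbb{T}=\{0,1,\mathfrak{u}\}$. The basic gates act on $\mathbb{T}$ by Kleene's strong logic: $\mathtt{and}$ outputs $0$ if some input is $0$, $1$ if both inputs are $1$, and $\mathfrak{u}$ otherwise; $\mathtt{or}$ outputs $1$ if some input is $1$, $0$ if both inputs are $0$, and $\mathfrak{u}$ otherwise; $\mathtt{not}(0)=1$, $\mathtt{not}(1)=0$, $\mathtt{not}(\mathfrak{u})=\mathfrak{u}$. A circuit is a combinational (acyclic) circuit of two-input $\mathtt{and}$, two-input $\mathtt{or}$, $\mathtt{not}$, and constant-$0$/constant-$1$ gates; a circuit $C$ with $N$ inputs and $M$ outputs computes a function $C:\mathbb{T}^N\to\mathbb{T}^M$ by induction on its structure. Its size is its number of gates and its depth is the maximal number of gates on a path from input to output. Superposition: for $x,y\in\mathbb{T}$, $x*y=x$ if $x=y$ and $x*y=\mathfrak{u}$ otherwise; extended componentwise to strings. It is associative and commutative, so the superposition of a nonempty finite set (or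 family) of strings is defined. Resolution: for $x\in\mathbb{T}^N$, $\mathrm{res}(x)=\{y\in\mathbb{B}^N : x_i\ne\mathfrak{u}\Rightarrow y_i=x_i \text{ for all } i\}$. The hazard-free extension of $f:\mathbb{B}^N\to\mathbb{B}^M$ is $f_{\mathfrak{u}}:\mathbb{T}^N\to\mathbb{T}^M$, where $f_{\mathfrak{u}}(x)$ is the superposition of all $f(y)$, $y\in\mathrm{res}(x)$. A circuit $C$ implements $f$ if $C(x)=f(x)$ for all $x\in\mathbb{B}^N$. A circuit $C$ implementing $f$ is hazard-free if $C(x)=f_{\mathfrak{u}}(x)$ for every $x\in\mathbb{T}^N$. A Mealy machine $T=(S,s_0,\Sigma,\Lambda,t,o)$ consists of a finite set of states $S$, a starting state $s_0\in S$, finite input alphabet $\Sigma$, finite output alphabet $\Lambda$, a state transition function $t:S\times\Sigma\to S$, and an output function $o:S\times\Sigma\to\Lambda$. Its transcription function $\tau_{T,n}:\Sigma^n\to\Lambda^n$ is given by $\tau_{T,n}(x)_i=o(s_{i-1},x_i)$ for $i\in\{1,\dots,n\}$, where $s_i=t(s_{i-1},x_i)$. When $\Sigma=\mathbb{B}^\ell$ and $\Lambda\subseteq\mathbb{B}^m$, $\tau_{T,n}$ is regarded as a Boolean function $\mathbb{B}^{\ell n}\to\mathbb{B}^{mn}$ by concatenating symbols. *)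

(* Defs.v *)
From HB Require Import structures.
From mathcomp Require Import all_boot all_order all_algebra.
From mathcomp Require Import reals exp.

Set Implicit Arguments.
Unset Strict Implicit.
Unset Printing Implicit Defensive.

(* [Some b] is the Boolean value [b]; [None] is the unstable value u. *)
Definition ternary : Type := option bool.

Definition tand (x y : ternary) : ternary :=
  match x, y with
  | Some false, _ | _, Some false => Some false
  | Some true, Some true => Some true
  | _, _ => None
  end.

Definition tor (x y : ternary) : ternary :=
  match x, y with
  | Some true, _ | _, Some true => Some true
  | Some false, Some false => Some false
  | _, _ => None
  end.

Definition tnot (x : ternary) : ternary :=
  match x with
  | Some b => Some (~~ b)
  | None => None
  end.

(* Gates name their operands by node number, see [circuit]. *)
Inductive gate : Type :=
| And of nat & nat
| Or of nat & nat
| Not of nat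
| Const of bool.

Definition operands (g : gate) : seq nat :=
  match g with
  | And i j | Or i j => [:: i; j]
  | Not i => [:: i]
  | Const _ => [::]
  end.

Definition gate_value (v : seq ternary) (g : gate) : ternary :=
  match g with
  | And i j => tand (nth None v i) (nth None v j)
  | Or i j => tor (nth None v i) (nth None v j)
  | Not i => tnot (nth None v i)
  | Const b => Some b
  end.

Fixpoint topological (k : nat) (gs : seq gate) : bool :=
  if gs is g :: gs' then
    all (fun i => i < k) (operands g) && topological k.+1 gs'
  else true.

(* A circuit is an acyclic graph listed in a topological order: nodes
   0, ..., N - 1 are the inputs and node N + k is the k-th gate, whose operands
   are earlier nodes. Fan-out is unrestricted, and an output may be any node. *)
Record circuit (N M : nat) : Type := Circuit {
  gates : seq gate;
  outputs : M.-tuple nat;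
  gates_topological : topological N gates;
  outputs_valid : all (fun i => i < N + size gates) outputs
}.

Section Circuit.
Variables N M : nat.
Implicit Type C : circuit N M.

Definition node_values C (x : N.-tuple ternary) : seq ternary :=
  foldl (fun v g => rcons v (gate_value v g)) x (gates C).

Definition eval C (x : N.-tuple ternary) : M.-tuple ternary :=
  map_tuple (nth None (node_values C x)) (outputs C).

Definition circuit_size C : nat := size (gates C).

Definition node C : finType := 'I_(N + size (gates C)).

Definition wire C : rel (node C) := fun u v =>
  (N <= v) && (val u \in operands (nth (Const false) (gates C) (v - N))).

(* The path u :: p runs from an input to an output; its gates are the nodes
   of p. *)
Definition io_path C (u : node C) (p : seq (node C)) : bool :=
  [&& u < N, path (@wire C) u p & val (last u p) \in outputs C].

(* Restricting to d <= size (gates C) loses no path, see [io_path_depth]. *)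
Definition depth C : nat :=
  \max_(d < (size (gates C)).+1
        | [exists u : node C, exists p : d.-tuple (node C), io_path u p]) d.

Lemma topological_nth k gs i j : topological k gs ->
  i \in operands (nth (Const false) gs j) -> i < k + j.
Proof.
elim: gs k j => [|g gs IH] k [|j] //= /andP[/allP Hg Hgs] Hi.
  by rewrite addn0 Hg.
by rewrite addnS -addSn; apply: IH.
Qed.

Lemma wire_lt C (u v : node C) : wire u v -> u < v.
Proof.
case/andP=> Nv /(topological_nth (gates_topological C)).
by rewrite subnKC.
Qed.

Lemma io_path_depth C (u : node C) (p : seq (node C)) :
  io_path u p -> size p <= depth C.
Proof.
move=> Hp; have /and3P[uN pathp _] := Hp.
have le_last : forall (q : seq (node C)) w,
    path (@wire C) w q -> w + size q <= last w q.
  elim=> [|a q IH] w /=; first by rewrite addn0.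
  by case/andP=> /wire_lt wa /IH; apply: leq_trans; rewrite addnS -addSn leq_add2r.
have lt_p : size p < (size (gates C)).+1.
  case: p pathp {Hp} => [|v p] //= /andP[/andP[Nv _] /le_last Hl].
  rewrite ltnS -(ltn_add2l N).
  have := leq_ltn_trans Hl (ltn_ord _); apply: leq_ltn_trans.
  by rewrite leq_add2r.
rewrite /depth (bigmax_sup (Ordinal lt_p)) //=.
by apply/existsP; exists u; apply/existsP; exists (in_tuple p).
Qed.

End Circuit.

Definition superpose1 (x y : ternary) : ternary := if x == y then x else None.

Definition superpose (M : nat) (x y : M.-tuple ternary) : M.-tuple ternary :=
  [tuple superpose1 (tnth x i) (tnth y i) | i < M].

Lemma superpose1A : associative superpose1.
Proof. by move=> [[]|] [[]|] [[]|]. Qed.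

Lemma superpose1C : commutative superpose1.
Proof. by move=> [[]|] [[]|]. Qed.

(* Only meaningful on nonempty families; the value on [::] is junk. *)
Definition superposition (M : nat) (s : seq (M.-tuple ternary)) :
    M.-tuple ternary :=
  if s is x :: s' then foldl (@superpose M) x s' else nseq_tuple M None.

Definition embed (N : nat) (x : N.-tuple bool) : N.-tuple ternary :=
  map_tuple some x.

Definition resolution (N : nat) (x : N.-tuple ternary) : {set N.-tuple bool} :=
  [set y : N.-tuple bool |
    [forall i, (tnth x i != None) ==> (Some (tnth y i) == tnth x i)]].

Lemma resolution_neq0 (N : nat) (x : N.-tuple ternary) : resolution x != set0.
Proof.
apply/set0Pn; exists (map_tuple (odflt false) x); rewrite inE.
by apply/forallP=> i; rewrite tnth_map; case: (tnth x i) => [b|] /=.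
Qed.

Definition hazard_free_extension (N M : nat)
    (f : N.-tuple bool -> M.-tuple bool) (x : N.-tuple ternary) :
    M.-tuple ternary :=
  superposition [seq embed (f y) | y <- enum (resolution x)].

Definition implements (N M : nat) (C : circuit N M)
    (f : N.-tuple bool -> M.-tuple bool) : Prop :=
  forall x : N.-tuple bool, eval C (embed x) = embed (f x).

Definition hazard_free (N M : nat) (C : circuit N M)
    (f : N.-tuple bool -> M.-tuple bool) : Prop :=
  forall x : N.-tuple ternary, eval C x = hazard_free_extension f x.

Record mealy (Sigma Lambda : finType) : Type := Mealy {
  state : finType;
  start : state;
  trans : state -> Sigma -> state;
  out : state -> Sigma -> Lambda
}.

Definition transcription (Sigma Lambda : finType) (T : mealy Sigma Lambda)
    (n : nat) (x : n.-tuple Sigma) : n.-tuple Lambda :=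
  [tuple out (foldl (@trans _ _ T) (start T) (take i x)) (tnth x i) | i < n].

Section Strings.
Variables l n : nat.

Lemma concat_subproof (x : n.-tuple (l.-tuple bool)) :
  size (flatten [seq val w | w <- x]) == l * n.
Proof.
rewrite size_flatten /shape -map_comp (@eq_map _ _ _ (fun=> l)); last first.
  by move=> w /=; rewrite size_tuple.
by rewrite sumnE big_map big_const_seq count_predT size_tuple iter_addn_0.
Qed.

Definition concat (x : n.-tuple (l.-tuple bool)) : (l * n).-tuple bool :=
  Tuple (concat_subproof x).

Definition blocks (x : (l * n).-tuple bool) : n.-tuple (l.-tuple bool) :=
  [tuple [tuple nth false x (i * l + j) | j < l] | i < n].

Lemma concatK : cancel concat blocks.
Proof.
have nth_flat (s : seq (l.-tuple bool)) i j : i < size s -> j < l ->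
    nth false (flatten [seq val w | w <- s]) (i * l + j)
    = nth false (nth (nseq_tuple l false) s i) j.
  move=> + lt_j; elim: s i => [|w s IH] [|i] //= lt_i; rewrite nth_cat size_tuple.
    by rewrite add0n lt_j.
  by rewrite mulSn -addnA ltnNge leq_addr /= addKn IH.
move=> x; apply: eq_from_tnth => i; apply: eq_from_tnth => j.
rewrite !tnth_mktuple /= nth_flat ?size_tuple //.
by rewrite (tnth_nth (nseq_tuple l false)) (tnth_nth false).
Qed.

End Strings.

Definition transcription_bool (l m : nat) (Lambda : {set m.-tuple bool})
    (T : mealy (l.-tuple bool) {y : m.-tuple bool | y \in Lambda}) (n : nat)
    (x : (l * n).-tuple bool) : (m * n).-tuple bool :=
  concat (map_tuple val (transcription T (blocks x))).

Definition log2 (R : realType) (x : R) : R := (ln x / ln 2)%R.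

(* Main.v *)
(* Kleene logic is tracked in dual-rail form: a ternary value is the nonempty
   set of Booleans it can still resolve to, and a gate is determined by which
   Booleans its output can resolve to. The set of states reachable on a block
   of letters is encoded, for every set [A] of states, by the ternary bit "the
   state lies in [A]". Two consecutive blocks compose by
     [q in A after both] = OR over B of
       ([state in B after the first] AND, for all r in B, [r leads into A]),
   which is exact because [B] may be any set of states. A linear-size parallel
   prefix circuit therefore yields all reachable sets. Multiplexer trees made
   of hazard-free multiplexers read the letters: Shannon's sharing of the
   subfunctions of about log l bits saves the factor l for the transitions,
   and the leaf for letter [y] of an output tree is the reachability bit of the
   set of states which output 1 on [y]. *)
Require Import Defs.
From HB Require Import structures.
From mathcomp Require Import all_boot all_order all_algebra.
From mathcomp Require Import reals exp.
From mathcomp Require Import boolp zify lra.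

Set Implicit Arguments.
Unset Strict Implicit.
Unset Printing Implicit Defensive.
Import Order.TTheory GRing.Theory Num.Theory.
Local Open Scope nat_scope.

(** * Dual-rail reading of Kleene logic *)

(* The value [v] can resolve to [b]. *)
Definition can (b : bool) (v : ternary) : bool := v != Some (~~ b).

Lemma can_inj v w : (forall b, can b v = can b w) -> v = w.
Proof.
move=> H; have := H true; have := H false.
by case: v w {H} => [[]|] [[]|].
Qed.

Lemma can_total v : can true v || can false v.
Proof. by case: v => [[]|]. Qed.

Lemma can_some b c : can b (Some c) = (c == b).
Proof. by case: b c => [] []. Qed.

Lemma can_tand b v w :
  can b (tand v w) = if b then can b v && can b w else can b v || can b w.
Proof. by case: b v w => [] [[]|] [[]|]. Qed.

Lemma can_tor b v w :
  can b (tor v w) = if b then can b v || can b w else can b v && can b w.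
Proof. by case: b v w => [] [[]|] [[]|]. Qed.

Lemma can_tnot b v : can b (tnot v) = can (~~ b) v.
Proof. by case: b v => [] [[]|]. Qed.

Lemma can_superpose1 b v w : can b (superpose1 v w) = can b v || can b w.
Proof. by case: b v w => [] [[]|] [[]|]. Qed.

(** * Folds that append one entry per gate *)

Section Grow.
Variables (A B : Type) (F : seq A -> B -> A) (x0 : A).

(** Node values and node levels are both folds of this form, so they share the lookup lemmas. *)
Definition grow (v : seq A) (gs : seq B) : seq A :=
  foldl (fun v g => rcons v (F v g)) v gs.

Lemma size_grow v gs : size (grow v gs) = size v + size gs.
Proof.
elim: gs v => [|g gs IH] v /=; first by rewrite addn0.
by rewrite IH size_rcons addSnnS.
Qed.

Lemma nth_grow v gs i : i < size v -> nth x0 (grow v gs) i = nth x0 v i.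
Proof.
elim: gs v => [|g gs IH] v //= lt_i.
by rewrite IH ?size_rcons ?nth_rcons ?lt_i // ltnW.
Qed.

Lemma nth_grow_cat v gs gs' i : i < size v + size gs ->
  nth x0 (grow v (gs ++ gs')) i = nth x0 (grow v gs) i.
Proof. by move=> lt_i; rewrite /grow foldl_cat nth_grow ?size_grow. Qed.

Lemma nth_grow_gate v gs b0 j : j < size gs ->
  nth x0 (grow v gs) (size v + j) =
  F (grow v (take j gs)) (nth b0 gs j).
Proof.
move=> lt_j; rewrite -{1}(cat_take_drop j.+1 gs) nth_grow_cat; last first.
  by rewrite size_takel // ltn_add2l.
rewrite (take_nth b0) // -cats1 /grow foldl_cat /= nth_rcons.
by rewrite -/(grow v _) size_grow (size_takel (ltnW lt_j)) ltnn eqxx.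
Qed.

End Grow.

(** * Cost-tracked construction of gate lists *)

Section Build.
Variable N : nat.
Implicit Types (x : N.-tuple ternary) (gs : seq gate) (d c i : nat).

Definition spec := N.-tuple ternary -> bool -> Prop.
Implicit Types P Q : spec.

Definition run gs x : seq ternary := grow gate_value x gs.

(** The number of gates on a longest path ending at the gate; a constant has level 1, the empty
    maximum being 0. *)
Definition gate_level (v : seq nat) (g : gate) : nat :=
  (\max_(i <- operands g) nth 0 v i).+1.

Definition levels gs : seq nat := grow gate_level (nseq N 0) gs.

(* Some node of [gs] at level at most [d] can resolve to [b] exactly
   when [P x b] holds. *)
Definition avail gs d P : Prop := exists i,
  [/\ i < N + size gs, nth 0 (levels gs) i <= d
    & forall x b, can b (nth None (run gs x) i) <-> P x b].

(** A state monad with additive cost: gates are only appended, so node numbers stay valid and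
    everything built earlier can be shared. *)
Definition ext gs c (D : seq gate -> Prop) : Prop := topological N gs ->
  exists gs', [/\ topological N (gs ++ gs'), size gs' <= c & D (gs ++ gs')].

Lemma avail_cat gs gs' d P : avail gs d P -> avail (gs ++ gs') d P.
Proof.
case=> i [lt_i le_d HP]; exists i; rewrite size_cat addnA ltn_addr //.
rewrite /levels /run nth_grow_cat ?size_nseq //; split=> // x b.
by rewrite nth_grow_cat ?size_tuple; [apply: HP|].
Qed.

Lemma avail_sub gs d d' P Q : avail gs d P -> d <= d' ->
  (forall x b, P x b <-> Q x b) -> avail gs d' Q.
Proof.
case=> i [lt_i le_d HP] le_d' PQ; exists i; split=> // [|x b].
  exact: leq_trans le_d'.
by rewrite -PQ.
Qed.

Lemma avail_weaken gs d d' P : avail gs d P -> d <= d' -> avail gs d' P.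
Proof. by move=> HP le_d; apply: avail_sub HP le_d _. Qed.

Lemma avail_input gs d i : i < N -> avail gs d (fun x b => can b (nth None x i)).
Proof.
move=> lt_i; exists i; rewrite ltn_addr // /levels /run.
rewrite nth_grow ?size_nseq // nth_nseq lt_i; split=> // x b.
by rewrite nth_grow ?size_tuple.
Qed.

Lemma ext_ret gs c (D : seq gate -> Prop) : D gs -> ext gs c D.
Proof. by move=> HD top; exists [::]; rewrite cats0. Qed.

Lemma ext_sub gs c c' (D D' : seq gate -> Prop) : ext gs c D -> c <= c' ->
  (forall gs', D (gs ++ gs') -> D' (gs ++ gs')) -> ext gs c' D'.
Proof.
move=> H le_c DD' /H[gs' [top le_s /DD' HD]]; exists gs'; split=> //.
exact: leq_trans le_c.
Qed.

Lemma ext_leq gs c c' (D : seq gate -> Prop) :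
  c <= c' -> ext gs c D -> ext gs c' D.
Proof. by move=> le_c H; apply: ext_sub H le_c _. Qed.

Lemma ext_bind gs c c' (D D' : seq gate -> Prop) : ext gs c D ->
  (forall gs', D (gs ++ gs') -> ext (gs ++ gs') c' D') -> ext gs (c + c') D'.
Proof.
move=> H DD' /H[gs1 [top1 le1 /DD'/(_ top1)[gs2 [top2 le2 HD']]]].
by exists (gs1 ++ gs2); rewrite size_cat leq_add // catA.
Qed.

Lemma ext_all (K : eqType) (s : seq K) gs c (D : K -> seq gate -> Prop) :
    (forall k gs1 gs2, D k gs1 -> D k (gs1 ++ gs2)) ->
    (forall k gs', k \in s -> ext (gs ++ gs') c (D k)) ->
  ext gs (size s * c) (fun gs' => forall k, k \in s -> D k gs').
Proof.
move=> stable; elim: s gs => [|k s IH] gs Hs /=; first exact: ext_ret.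
rewrite mulSn; apply: (@ext_bind _ _ _ (D k)).
  by rewrite -[gs]cats0; apply: Hs; rewrite mem_head.
move=> gs1 Dk; apply: (ext_sub (IH _ _)) => // [k' gs' sk'|gs2 HD k'].
  by rewrite -catA; apply: Hs; rewrite inE sk' orbT.
by rewrite inE => /predU1P[->|/HD //]; apply: stable.
Qed.

Lemma topological_cat k gs gs' :
  topological k (gs ++ gs') = topological k gs && topological (k + size gs) gs'.
Proof.
elim: gs k => [|g gs IH] k /=; first by rewrite addn0.
by rewrite IH addSnnS andbA.
Qed.

Lemma ext_gate g gs d P :
    all (fun i => i < N + size gs) (operands g) ->
    all (fun i => nth 0 (levels gs) i <= d) (operands g) ->
    (forall x b, can b (gate_value (run gs x) g) <-> P x b) ->
  ext gs 1 (fun gs' => avail gs' d.+1 P).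
Proof.
move=> ops /allP lev HP top; exists [:: g]; split=> //.
  by rewrite topological_cat top /= ops.
exists (N + size gs); rewrite size_cat /= addn1 addnS leqnn; split=> //.
  rewrite -[X in nth 0 _ (X + _)](size_nseq N 0).
  rewrite (nth_grow_gate _ _ _ (Const false)); last first.
    by rewrite size_cat addn1.
  rewrite take_size_cat // nth_cat ltnn subnn /= ltnS.
  by rewrite big_seq; apply/bigmax_leqP_seq => i iops _; apply: lev.
move=> x b; rewrite -HP -[X in nth None _ (X + _)](size_tuple x).
rewrite (nth_grow_gate _ _ _ (Const false)) ?size_cat ?addn1 //.
by rewrite take_size_cat // nth_cat ltnn subnn.
Qed.

Lemma ext_and gs d P Q : avail gs d P -> avail gs d Q -> ext gs 1 (fun gs' =>
  avail gs' d.+1 (fun x b => if b then P x b /\ Q x b else P x b \/ Q x b)).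
Proof.
move=> [i [lti levi Hi]] [j [ltj levj Hj]].
apply: (@ext_gate (And i j)) => /=; rewrite ?lti ?ltj ?levi ?levj // => x b.
rewrite can_tand; have := Hi x b; have := Hj x b.
by case: b => -[? ?] [? ?]; split;
  [move/andP|move=> ?; apply/andP|move/orP|move=> ?; apply/orP]; tauto.
Qed.

Lemma ext_or gs d P Q : avail gs d P -> avail gs d Q -> ext gs 1 (fun gs' =>
  avail gs' d.+1 (fun x b => if b then P x b \/ Q x b else P x b /\ Q x b)).
Proof.
move=> [i [lti levi Hi]] [j [ltj levj Hj]].
apply: (@ext_gate (Or i j)) => /=; rewrite ?lti ?ltj ?levi ?levj // => x b.
rewrite can_tor; have := Hi x b; have := Hj x b.
by case: b => -[? ?] [? ?]; split;
  [move/orP|move=> ?; apply/orP|move/andP|move=> ?; apply/andP]; tauto.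
Qed.

Lemma ext_not gs d P : avail gs d P ->
  ext gs 1 (fun gs' => avail gs' d.+1 (fun x b => P x (~~ b))).
Proof.
move=> [i [lti levi Hi]].
apply: (@ext_gate (Not i)) => /=; rewrite ?lti ?levi // => x b.
by rewrite can_tnot.
Qed.

Lemma ext_const gs (e : bool) : ext gs 1 (fun gs' => avail gs' 1 (fun _ b => e = b)).
Proof.
apply: (@ext_gate (Const e)) => //= x b.
by rewrite can_some; split=> [/eqP|->].
Qed.

(* The disjunct [P /\ Q] of the multiplexer removes the hazard that occurs
   when the selector is unstable and both branches agree. *)
Lemma ext_mux gs d i P Q : i < N -> avail gs d P -> avail gs d Q ->
  ext gs 6 (fun gs' => avail gs' (d + 4) (fun x b =>
    (can true (nth None x i) /\ P x b) \/ (can false (nth None x i) /\ Q x b))).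
Proof.
(* One negation, three conjunctions and two disjunctions; the longest path runs through the
   negation, a conjunction and both disjunctions, hence depth 4. *)
move=> lt_i HP HQ; rewrite -[6]/(1 + (1 + (1 + (1 + (1 + 1))))).
have Hi gs' := avail_input gs' d lt_i.
apply: (ext_bind (ext_not (Hi _))) => g1 H1.
apply: (ext_bind (ext_and (Hi _) (avail_cat g1 HP))) => g2 H2.
have HQ1 := avail_weaken (avail_cat g2 (avail_cat g1 HQ)) (leqnSn d).
apply: (ext_bind (ext_and (avail_cat g2 H1) HQ1)) => g3 H3.
have HP2 := avail_cat g3 (avail_cat g2 (avail_cat g1 HP)).
apply: (ext_bind (ext_and HP2 (avail_cat g3 (avail_cat g2 (avail_cat g1 HQ))))).
move=> g4 H4.
have H23 := avail_weaken (avail_cat g4 (avail_cat g3 H2)) (leqnSn d.+1).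
apply: (ext_bind (ext_or H23 (avail_cat g4 H3))) => g5 H5.
have H45 := avail_weaken (avail_cat g5 H4) (leqW (leqnSn d.+1)).
apply: (ext_sub (ext_or H5 H45)) => // gs' HR.
apply: avail_sub HR _ _ => [|x b]; first by rewrite addn4.
(* The selector can always resolve to some Boolean; otherwise [P /\ Q] could hold with no branch
   selected. *)
have := can_total (nth None x i).
have [tt ff] : true /\ ~ false by [].
by case: b; case: (can true _) (can false _) => [] [] //= _; tauto.
Qed.

(** * Multiplexer trees over input wires *)

(* The wires listed in [sel] can jointly resolve to the bits [y]. *)
Definition compat x (sel : seq nat) (y : seq bool) : bool :=
  (size y == size sel) && all2 (fun i b => can b (nth None x i)) sel y.

Lemma compat_cons x i sel e y :
  compat x (i :: sel) (e :: y) = can e (nth None x i) && compat x sel y.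
Proof. by rewrite /compat /= eqSS andbCA. Qed.

Lemma compat_cat x sel1 sel2 y : compat x (sel1 ++ sel2) y <->
  exists y1 y2, [/\ y = y1 ++ y2, compat x sel1 y1 & compat x sel2 y2].
Proof.
elim: sel1 y => [|i sel1 IH] y /=.
  split=> [Hy|]; first by exists [::], y.
  by case=> -[|? ?] [y2 [->]].
split; last first.
  case=> -[|e y1] [y2 [->]] //=.
  by rewrite !compat_cons => /andP[-> H1] H2; apply/IH; exists y1, y2.
case: y => [//|e y]; rewrite compat_cons => /andP[He /IH[y1 [y2 [-> H1 H2]]]].
by exists (e :: y1), y2; rewrite compat_cons He.
Qed.

(** Each multiplexer unites the possible values of the branches its selector may choose, so exactly
    the leaves compatible with the wires contribute. *)
Lemma ext_tree gs sel d (G : seq bool -> spec) : all (gtn N) sel ->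
    (forall y, size y = size sel -> avail gs d (G y)) ->
  ext gs (6 * 2 ^ size sel) (fun gs' => avail gs' (d + 4 * size sel)
    (fun x b => exists2 y, compat x sel y & G y x b)).
Proof.
move=> Hsel HG.
(* A binary tree has one multiplexer fewer than leaves; this sharper count adds up exactly in the
   induction. *)
suff: ext gs (6 * (2 ^ size sel).-1) (fun gs' => avail gs' (d + 4 * size sel)
    (fun x b => exists2 y, compat x sel y & G y x b)).
  by apply: ext_leq; rewrite leq_pmul2l ?leq_pred.
elim: sel G gs Hsel HG => [|i sel IH] G gs /=.
  move=> _ /(_ [::] erefl) HG; apply: ext_ret.
  apply: avail_sub HG (leq_addr _ _) _ => x b.
  by split=> [|[[] //]]; exists [::].
case/andP=> lt_i Hsel HG.
have HGc e y : size y = size sel -> avail gs d (G (e :: y)).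
  by move=> sz; apply: HG; rewrite /= sz.
have -> : 6 * (2 ^ (size sel).+1).-1 =
    6 * (2 ^ size sel).-1 + (6 * (2 ^ size sel).-1 + 6).
  have := expn_gt0 2 (size sel); rewrite expnS /=; lia.
apply: (ext_bind (IH _ _ Hsel (HGc true))) => g1 H1.
apply: (ext_bind (IH _ _ Hsel (fun y sz => avail_cat g1 (HGc false y sz)))).
move=> g2 H2; apply: (ext_sub (ext_mux lt_i (avail_cat g2 H1) H2)) => // gs'.
move/avail_sub; apply=> [|x b]; first by lia.
split.
  by case=> -[Hi [y Hy Gy]]; [exists (true :: y)|exists (false :: y)];
    rewrite // compat_cons Hi.
by case=> -[//|[] y]; rewrite compat_cons => /andP[Hi Hy] Gy; [left|right];
  split=> //; exists y.
Qed.

(** A function of [i :: sel] is one multiplexer on wire [i] between its two cofactors, which are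
    among the functions of [sel] already built. *)
Lemma ext_all_functions gs sel : all (gtn N) sel ->
  ext gs (12 * 2 ^ 2 ^ size sel) (fun gs' =>
    forall phi : {ffun (size sel).-tuple bool -> bool},
      avail gs' (1 + 4 * size sel) (fun x b =>
        exists2 y : (size sel).-tuple bool, compat x sel y & phi y = b)).
Proof.
elim: sel gs => [|i sel IH] gs /=.
  move=> _; apply: (@ext_leq _ (1 + 1)) => //.
  apply: (ext_bind (@ext_const _ true)) => g1 H1.
  apply: (ext_sub (@ext_const _ false)) => // gs' H0 phi.
  have : avail ((gs ++ g1) ++ gs') 1 (fun _ b => phi [tuple] = b).
    by case: (phi _); [apply: avail_cat|].
  move/avail_sub; apply=> // x b; split=> [Hb|[y _ <-]].
    by exists [tuple].
  by congr (phi _); apply: val_inj; case: (y) => -[].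
case/andP=> lt_i Hsel.
(* With [a = 2 ^ 2 ^ size sel] there are [a ^ 2] new functions, and
   [12 * a + 6 * a ^ 2 <= 12 * a ^ 2] because [a >= 2]. *)
apply: (@ext_leq _ (12 * 2 ^ 2 ^ size sel + 2 ^ 2 ^ (size sel).+1 * 6)).
  have : 2 <= 2 ^ 2 ^ size sel by rewrite -{1}(expn1 2) leq_exp2l ?expn_gt0.
  by rewrite (expnS 2 (size sel)) mul2n -addnn expnD; nia.
apply: (ext_bind (IH _ Hsel)) => g1 H1.
pose F (phi : {ffun (size sel).+1.-tuple bool -> bool}) gs' :=
  avail gs' (1 + 4 * (size sel).+1) (fun x b =>
    exists2 y : (size sel).+1.-tuple bool, compat x (i :: sel) y & phi y = b).
have card_phi : size (enum {ffun (size sel).+1.-tuple bool -> bool}) =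
    2 ^ 2 ^ (size sel).+1.
  by rewrite -cardE card_ffun card_tuple card_bool.
rewrite -card_phi.
apply: (@ext_sub _ _ _ (fun gs' => forall phi,
  phi \in enum {ffun (size sel).+1.-tuple bool -> bool} -> F phi gs')
  _ _ (leqnn _)).
  apply: ext_all => [phi g2 g3|phi g2 _]; first exact: avail_cat.
  pose cof e := [ffun y : (size sel).-tuple bool => phi (cons_tuple e y)].
  have Hcof e := avail_cat g2 (H1 (cof e)).
  apply: (ext_sub (ext_mux lt_i (Hcof true) (Hcof false))) => // gs'.
  move/avail_sub; apply=> [|x b]; first by lia.
  split.
    by case=> -[Hi [y Hy]]; rewrite ffunE => Hb;
      [exists (cons_tuple true y)|exists (cons_tuple false y)];
      rewrite //= compat_cons Hi.
  case=> y; rewrite (tuple_eta y) /= compat_cons.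
  case: (thead y) => /andP[Hi Hy] Hb; [left|right]; split=> //;
    by exists (behead_tuple y); rewrite ?ffunE.
by move=> gs' H phi; apply: H; rewrite mem_enum.
Qed.

(* Shannon's construction: the multiplexer trees over [sel1] share the
   circuits computing all Boolean functions of the wires in [sel2]. *)
Lemma ext_functions (K : eqType) (s : seq K) (Phi : K -> seq bool -> bool)
    gs sel1 sel2 : all (gtn N) (sel1 ++ sel2) ->
  ext gs (12 * 2 ^ 2 ^ size sel2 + size s * (6 * 2 ^ size sel1)) (fun gs' =>
    forall k, k \in s -> avail gs' (1 + 4 * size (sel1 ++ sel2)) (fun x b =>
      exists2 y, compat x (sel1 ++ sel2) y & Phi k y = b)).
Proof.
rewrite all_cat => /andP[Hsel1 Hsel2].
apply: (ext_bind (ext_all_functions Hsel2)) => g1 H1.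
apply: ext_all => [k g2 g3|k g2 _]; first exact: avail_cat.
pose G y1 : spec := fun x b => exists2 y : (size sel2).-tuple bool,
  compat x sel2 y & [ffun y : (size sel2).-tuple bool => Phi k (y1 ++ y)] y = b.
apply: (ext_sub (ext_tree (G := G) Hsel1 (fun y _ => avail_cat g2 (H1 _)))) => //.
move=> gs' /avail_sub; apply=> [|x b]; first by rewrite size_cat; lia.
split=> [[y1 Hy1 [y2 Hy2]]|[y /compat_cat[y1 [y2 [-> H1' H2]]] Hb]].
  by rewrite ffunE => Hb; exists (y1 ++ y2) => //; apply/compat_cat; exists y1, y2.
exists y1 => //; have sz2 : size y2 == size sel2 by case/andP: H2.
by exists (Tuple sz2); rewrite ?ffunE.
Qed.

(** * Iterated gates and parallel prefixes *)

Lemma ext_or_tree (K : eqType) (s : seq K) (P : K -> spec) gs d k :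
    s != [::] -> size s <= 2 ^ k -> (forall t, t \in s -> avail gs d (P t)) ->
  ext gs (size s).-1 (fun gs' => avail gs' (d + k) (fun x b =>
    if b then exists2 t, t \in s & P t x b
    else forall t, t \in s -> P t x b)).
Proof.
elim: k s gs => [|k IH] s gs s_neq0 le_s HP.
  case: s s_neq0 le_s HP => [//|t []//] _ _ /(_ t (mem_head _ _)) HP.
  apply: ext_ret; apply: avail_sub HP (leq_addr _ _) _ => x [].
    by split=> [|[t' /[!inE]/eqP->//]]; exists t; rewrite ?mem_head.
  by split=> [? t' /[!inE]/eqP->|]//; apply; rewrite mem_head.
have [le_k|lt_k] := leqP (size s) (2 ^ k).
  apply: ext_sub (IH _ _ s_neq0 le_k HP) (leqnn _) _ => gs'.
  by move/avail_weaken; apply; rewrite addnS.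
(* Splitting off a full block of [2 ^ k] terms keeps the depth logarithmic, so a disjunction over
   all sets of states adds only [|S|] levels. *)
have szt : size (take (2 ^ k) s) = 2 ^ k by rewrite size_takel // ltnW.
have szd : size (drop (2 ^ k) s) = size s - 2 ^ k by rewrite size_drop.
have k_gt0 := expn_gt0 2 k.
have mem_s t : t \in s = (t \in take (2 ^ k) s) || (t \in drop (2 ^ k) s).
  by rewrite -mem_cat cat_take_drop.
apply: (@ext_leq _ ((size (take (2 ^ k) s)).-1 +
                    ((size (drop (2 ^ k) s)).-1 + 1))).
  by rewrite szt szd; lia.
apply: ext_bind (IH _ _ _ _ _) _ => [|||gs1 H1].
- by rewrite -size_eq0 szt -lt0n.
- by rewrite szt.
- by move=> t st; apply: HP; rewrite mem_s st.
apply: ext_bind (IH _ _ _ _ _) _ => [|||gs2 H2].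
- by rewrite -size_eq0 szd -lt0n subn_gt0.
- by rewrite szd; move: le_s; rewrite expnS; lia.
- by move=> t st; apply: avail_cat; apply: HP; rewrite mem_s st orbT.
apply: ext_sub (ext_or (avail_cat _ H1) H2) (leqnn _) _ => gs'.
move/avail_sub; apply=> [|x []]; first by rewrite addnS.
  split=> [[] [t st Pt]|[t]]; try by exists t; rewrite // mem_s st ?orbT.
  by rewrite mem_s => /orP[] st Pt; [left|right]; exists t.
split=> [[Hl Hr] t|H]; first by rewrite mem_s => /orP[/Hl|/Hr].
by split=> t st; apply: H; rewrite mem_s st ?orbT.
Qed.

(** A chain is enough: it is used on at most [|S|] states, so its depth does not exceed that of the
    disjunction over the [2 ^ |S|] sets. *)
Lemma ext_and_chain (K : eqType) (s : seq K) (P : K -> spec) Q gs d :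
    avail gs d Q -> (forall t, t \in s -> avail gs d (P t)) ->
  ext gs (size s) (fun gs' => avail gs' (d + size s) (fun x b =>
    if b then Q x b /\ forall t, t \in s -> P t x b
    else Q x b \/ exists2 t, t \in s & P t x b)).
Proof.
elim: s gs => [|t s IH] gs HQ HP.
  apply: ext_ret; apply: avail_sub HQ (leq_addr _ _) _ => x [].
    by split=> [|[]].
  by split=> [|[|[]]] //; left.
have HPs u : u \in s -> avail gs d (P u).
  by move=> su; apply: HP; rewrite inE su orbT.
rewrite -[size (t :: s)]addn1; apply: ext_bind (IH _ HQ HPs) _ => gs1 H1.
have Ht : avail (gs ++ gs1) (d + size s) (P t).
  apply: avail_weaken (avail_cat _ (HP _ _)) (leq_addr _ _).
  exact: mem_head.
apply: ext_sub (ext_and H1 Ht) (leqnn _) _ => gs'.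
move/avail_sub; apply=> [|x []]; first by rewrite addnA addn1.
  split=> [[[HQx Hs] Hx]|[HQx Hs]].
    by split=> // u; rewrite inE => /predU1P[->|/Hs].
  by do !split=> //; [move=> u su|]; apply: Hs; rewrite inE ?su ?orbT ?eqxx.
split=> [[[|[u su Pu]]|Pt]|[|[u]]]; first by left.
- by right; exists u; rewrite // inE su orbT.
- by right; exists t; rewrite // mem_head.
- by left; left.
by rewrite inE => /predU1P[->|su] Pu; [right|left; right; exists u].
Qed.

(* Ladner and Fischer's parallel prefix computation: combine adjacent pairs,
   recurse on the pairs, then fill in the prefixes of odd length. *)
Lemma ext_scan (E : nat -> nat -> nat -> seq gate -> Prop) c D gs n d :
    (forall i j d gs gs', E i j d gs -> E i j d (gs ++ gs')) ->
    (forall i j d d' gs, d <= d' -> E i j d gs -> E i j d' gs) ->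
    (forall i j k d gs, i <= j -> j <= k -> E i j d gs -> E j k d gs ->
      ext gs c (E i k (d + D))) ->
    (forall i, i < n -> E i i.+1 d gs) ->
  ext gs (2 * n * c) (fun gs' => forall i, i < n ->
    E 0 i.+1 (d + 2 * D * trunc_log 2 n) gs').
Proof.
elim/ltn_ind: n E d gs => n IH E d gs stable mono comp init.
have [n_le1|n_gt1] := leqP n 1.
  apply: ext_ret => -[|i] lt_i; last by lia.
  by apply: mono (init _ lt_i); apply: leq_addr.
pose h := n./2; have odd_n := odd_double_half n; rewrite -/h in odd_n.
rewrite trunc_log2S // -/h.
(* There are [h] pairings, at most [2 * h] combinations in the recursion and [n.-1./2] fill-ins, in
   total at most [2 * n]. *)
apply: (@ext_leq _ (size (iota 0 h) * c + (2 * h * c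
  + size (iota 0 n.-1./2) * c))).
  rewrite !size_iota -!mulnDl leq_mul2r; apply/orP; right; lia.
pose pair i gs' := E i.*2 i.+1.*2 (d + D) gs'.
apply: (ext_bind (ext_all (D := pair) _ _)) => [i gs1 gs2|i gs'|gs1 Hpair].
- exact: stable.
- rewrite mem_iota => lt_i; apply: (comp _ i.*2.+1); try lia.
    by apply: stable; apply: init; lia.
  by apply: stable; apply: init; lia.
have h_lt : h < n by lia.
(* Item [i] of the recursive instance spans the items [i.*2] and [i.*2.+1]. *)
pose E2 i j := E i.*2 j.*2.
apply: (ext_bind (IH h h_lt E2 (d + D) _ _ _ _ _)) => [||||gs2 Heven].
- by move=> i j e gs2 gs3; apply: stable.
- by move=> i j e e' gs2; apply: mono.
- by move=> i j k e gs2 le_ij le_jk; apply: comp; rewrite leq_double.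
- by move=> i lt_i; apply: Hpair; rewrite mem_iota.
pose e := d + D + 2 * D * trunc_log 2 h.
(* The prefix of length [i.*2.+3] is an even one plus a single item; length 1 is an item itself.
   Each halving of [n] thus adds [2 * D] levels. *)
pose odds i gs' := E 0 i.*2.+3 (e + D) gs'.
apply: (ext_sub (ext_all (D := odds) _ _) (leqnn _)) => [i gs3 gs4|i gs3|gs3 Hodd].
- exact: stable.
- rewrite mem_iota => lt_i; apply: (comp _ i.*2.+2) => //.
    by apply: stable; apply: (Heven i); lia.
  do 3!apply: (stable).
  by apply: (mono _ _ d); [rewrite /e; lia|apply: init; lia].
(* Index [i] stands for the prefix of length [i.+1], so odd [i] come from the recursion. *)
move=> i lt_i; have := odd_double_half i; case: (odd i) => /= def_i.
  rewrite -def_i; apply: stable; apply: (mono _ _ e); first by rewrite /e; lia.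
  by apply: (Heven i./2); lia.
case: (i./2) def_i => [|r] def_i.
  rewrite -def_i; do 3!apply: (stable).
  by apply: (mono _ _ d); [lia|apply: init; lia].
have -> : i = r.*2.+2 by lia.
apply: (mono _ _ (e + D)); first by rewrite /e; lia.
by apply: Hodd; rewrite mem_iota; lia.
Qed.

End Build.

(** * From gate lists to circuits *)

Lemma level_wire N M (C : circuit N M) (u v : node C) : wire u v ->
  nth 0 (levels N (gates C)) u < nth 0 (levels N (gates C)) v.
Proof.
case/andP=> le_v Hu; have lt_v : v - N < size (gates C).
  by rewrite ltn_subLR.
have lt_u : u < N + (v - N) by apply: topological_nth (gates_topological C) Hu.
rewrite -[in X in _ < X](subnKC le_v) /levels.
rewrite -[X in nth 0 _ (X + (v - N))](size_nseq N 0).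
rewrite (nth_grow_gate _ _ _ (Const false)) // /gate_level ltnS.
rewrite -{1}(cat_take_drop (v - N) (gates C)) nth_grow_cat; last first.
  by rewrite size_nseq size_takel // ltnW.
exact: (bigmaxn_sup_seq (val u)).
Qed.
(** Levels increase strictly along wires, so they bound path lengths and hence the depth. *)
Lemma level_path N M (C : circuit N M) (u : node C) p :
  path (@wire N M C) u p ->
  nth 0 (levels N (gates C)) u + size p <= nth 0 (levels N (gates C)) (last u p).
Proof.
elim: p u => [|v p IH] u /=; first by rewrite addn0.
case/andP=> /level_wire Huv /IH; apply: leq_trans.
by rewrite addnS -addSn leq_add2r.
Qed.

(** Each output is wired to a witness node of its specification; [run] unfolds to the same fold as
    [node_values]. *)
Lemma circuit_of_avail N M gs d (P : 'I_M -> spec N) :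
    topological N gs -> (forall p, avail gs d (P p)) ->
  exists C : circuit N M, [/\ gates C = gs, depth C <= d
    & forall x p b, can b (tnth (eval C x) p) <-> P p x b].
Proof.
move=> top /fin_all_exists[out Hout].
have valid : all (fun i => i < N + size gs) [tuple out p | p < M].
  by apply/allP => _ /mapP[p _ ->]; case: (Hout p).
exists (Circuit top valid); split=> // [|x p b]; last first.
  by rewrite tnth_map tnth_mktuple; case: (Hout p) => _ _; apply.
apply/bigmax_leqP => k /existsP[u /existsP[q /and3P[_ Hq /mapP[p _ last_q]]]].
have := level_path Hq; rewrite size_tuple last_q.
by case: (Hout p) => _ Hp _ /leq_trans/(_ Hp); apply: leq_trans (leq_addl _ _).
Qed.

(** * Resolutions and hazard-free extensions *)

Lemma mem_resolution N (x : N.-tuple ternary) (y : N.-tuple bool) :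
  y \in resolution x <-> forall i, can (tnth y i) (tnth x i).
Proof.
rewrite inE; split=> [/forallP H i|H]; last (apply/forallP => i);
  by move: (H i); case: (tnth x i) (tnth y i) => [[]|] [].
Qed.

Lemma can_superposition M (s : seq (M.-tuple ternary)) p b : s != [::] ->
  can b (tnth (superposition s) p) <-> exists2 z, z \in s & can b (tnth z p).
Proof.
case: s => [//|z s] _ /=; elim: s z => [|w s IH] z /=.
  split=> [|[z' /[!inE]/eqP->//]]; by exists z; rewrite ?mem_head.
rewrite IH; split=> [[z' /[!inE]/predU1P[->|sz] Hz]|[z' /[!inE]/or3P[]]].
- move: Hz; rewrite tnth_mktuple can_superpose1 => /orP[] Hz.
    by exists z; rewrite // mem_head.
  by exists w; rewrite // !inE eqxx orbT.
- by exists z'; rewrite // !inE sz !orbT.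
- move/eqP-> => Hz; exists (superpose z w); rewrite ?mem_head //.
  by rewrite tnth_mktuple can_superpose1 Hz.
- move/eqP-> => Hz; exists (superpose z w); rewrite ?mem_head //.
  by rewrite tnth_mktuple can_superpose1 Hz orbT.
by move=> sz Hz; exists z'; rewrite // inE sz orbT.
Qed.

(** Superposition is union in dual-rail form and a stable bit is a singleton, so hazard-freeness can
    be checked for each output bit and each Boolean separately. *)
Lemma can_hazard_free_extension N M (f : N.-tuple bool -> M.-tuple bool) x p b :
  can b (tnth (hazard_free_extension f x) p) <->
  exists2 y, y \in resolution x & tnth (f y) p = b.
Proof.
rewrite can_superposition; last first.
  have /set0Pn[y Hy] := resolution_neq0 x.
  by apply/eqP => /(congr1 size); rewrite size_map -cardE (cardD1 y) Hy.
split=> [[_ /mapP[y + ->]]|[y Hy <-]].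
  by rewrite mem_enum tnth_map can_some => Hy /eqP; exists y.
exists (embed (f y)); first by apply: map_f; rewrite mem_enum.
by rewrite tnth_map can_some.
Qed.

(** A stable input has itself as its only resolution. *)
Lemma hazard_free_implements N M (C : circuit N M) f :
  hazard_free C f -> implements C f.
Proof.
move=> HC x; rewrite HC; apply: eq_from_tnth => p; apply: can_inj => b.
rewrite tnth_map can_some; apply/idP/eqP.
  case/can_hazard_free_extension => y /mem_resolution Hy <-.
  suff -> : y = x by [].
  apply: eq_from_tnth => i; have := Hy i.
  by rewrite tnth_map can_some => /eqP.
move=> <-; apply/can_hazard_free_extension; exists x => //.
by apply/mem_resolution => i; rewrite tnth_map can_some.
Qed.

(** * Letters as blocks of input wires *)

Section Blocks.
Variables l n : nat.
Implicit Types (x : (l * n).-tuple ternary) (i : nat) (y : l.-tuple bool).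

Definition wires i : seq nat := iota (i * l) l.

Lemma wires_lt i : i < n -> all (gtn (l * n)) (wires i).
Proof.
move=> lt_i; apply/allP => j; rewrite mem_iota => /andP[_ lt_j] /=.
by apply: leq_trans lt_j _; rewrite addnC -mulSn mulnC leq_mul2l lt_i orbT.
Qed.

Lemma compat_iota N (x : N.-tuple ternary) a k (y : k.-tuple bool) :
  compat x (iota a k) y <-> forall j : 'I_k, can (tnth y j) (nth None x (a + j)).
Proof.
elim: k a y => [|k IH] a y.
  by split=> [_ []//|_]; rewrite (tuple0 y).
rewrite [y]tuple_eta /= compat_cons.
split=> [/andP[Hhd /(IH a.+1 (behead_tuple y)) Htl] j|H].
  case: (unliftP ord0 j) => [j'|] ->; last by rewrite tnth0 addn0.
  by rewrite tnthS /= /bump addnS -addSn.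
apply/andP; split; first by have := H ord0; rewrite tnth0 addn0.
apply/(IH a.+1 (behead_tuple y)) => j; have := H (lift ord0 j).
by rewrite tnthS /= /bump addnS -addSn.
Qed.

(** Different letters use disjoint wires, so they resolve independently. *)
Lemma resolution_blocks x (Y : (l * n).-tuple bool) : Y \in resolution x <->
  forall i : 'I_n, compat x (wires i) (tnth (blocks Y) i).
Proof.
rewrite mem_resolution; split=> [H i|H p].
  apply/compat_iota => j; rewrite !tnth_mktuple.
  have lt_p : i * l + j < l * n.
    apply: leq_trans (_ : i.+1 * l <= _); first by rewrite mulSn addnC ltn_add2r.
    by rewrite mulnC leq_mul2l ltn_ord orbT.
  by have := H (Ordinal lt_p); rewrite !(tnth_nth None) (tnth_nth false).
have l_gt0 : 0 < l by case: l p => [[]|].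
have lt_i : p %/ l < n by rewrite ltn_divLR // [n * l]mulnC.
have lt_j : p %% l < l by rewrite ltn_mod.
have /compat_iota/(_ (Ordinal lt_j)) := H (Ordinal lt_i).
by rewrite !tnth_mktuple /= -divn_eq (tnth_nth None) (tnth_nth false).
Qed.

Lemma tnth_concat (z : n.-tuple (l.-tuple bool)) (i : 'I_n) (j : 'I_l) :
  nth false (concat z) (i * l + j) = tnth (tnth z i) j.
Proof. by rewrite -{2}(concatK z) !tnth_mktuple. Qed.

End Blocks.

(** * Runs of the machine on ternary input *)

Section Reach.
Variables (l n : nat) (St : finType) (t : St -> l.-tuple bool -> St).
Notation Sigma := (l.-tuple bool).
Implicit Types (x : (l * n).-tuple ternary) (p : St * {set St}).

(** Unstable bits make the machine nondeterministic: each letter may be any word its wires can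
    resolve to. *)
Fixpoint steps k i x (s q : St) : Prop :=
  if k is k'.+1 then
    exists2 y : Sigma, compat x (wires l i) y & steps k' i.+1 x (t s y) q
  else s = q.

Lemma steps_cat k k' i x s q : steps (k + k') i x s q <->
  exists2 r, steps k i x s r & steps k' (i + k) x r q.
Proof.
elim: k i s => [|k IH] i s /=.
  by rewrite addn0; split=> [|[_ <-]]; [exists s|].
split=> [[y Hy /IH[r Hr Hq]]|[r [y Hy Hr]]].
  by exists r; [exists y|rewrite addnS -addSn].
by rewrite addnS -addSn => Hq; exists y => //; apply/IH; exists r.
Qed.

Lemma steps_foldl k i x s q : steps k i x s q <-> exists ys : seq Sigma,
  [/\ size ys = k, foldl t s ys = q
    & forall r, r < k ->
      compat x (wires l (i + r)) (nth [tuple of nseq l false] ys r)].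
Proof.
elim: k i s => [|k IH] i s /=.
  split=> [->|[ys [/size0nil -> //]]]; by exists [::].
split=> [[y Hy /IH[ys [<- <- Hys]]]|].
  exists (y :: ys); split=> // -[|r] /=; first by rewrite addn0.
  by rewrite ltnS addnS -addSn; apply: Hys.
case=> -[|y ys] [] //= [sz] Hq Hys.
exists y; first by have := Hys 0 isT; rewrite addn0.
apply/IH; exists ys; split=> // r lt_r.
by have := Hys r.+1 lt_r; rewrite addnS -addSn.
Qed.

(* The membership bits of all sets of states encode the set of states
   reachable from [p.1] between letters [i] and [j]. *)
Definition reach i j p : spec (l * n) := fun x b =>
  exists2 q, steps (j - i) i x p.1 q & (q \in p.2) = b.

Definition reaches i j d gs : Prop := forall p, avail gs d (reach i j p).

(** Absorbs the polynomial factor in the gate count of one composition into a further power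
    [2 ^ |S|], which gives [2 ^ (3 * |S|)]. *)
Lemma muln_succ_le_exp k : k * k.+1 <= 2 * 2 ^ k.
Proof.
elim: k => [//|k IH]; have := ltn_expl k (isT : 1 < 2).
by rewrite [2 ^ k.+1]expnS; nia.
Qed.

(* A set [B] separates: the final state can lie in [A] iff some [B] contains
   a possible intermediate state and all of [B] can reach [A]. *)
Lemma ext_reach_cat i j k d gs : i <= j -> j <= k ->
  reaches i j d gs -> reaches j k d gs ->
  ext (l * n) gs (2 * 2 ^ (3 * #|St|)) (reaches i k (d + 2 * #|St|)).
Proof.
move=> le_ij le_jk Hij Hjk; set S := #|St|.

have card_sets : size (enum {set St}) = 2 ^ S.
  by rewrite -cardE -cardsT -powersetT card_powerset cardsT.
have card_idx : size (enum {: St * {set St}}) = S * 2 ^ S.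
  by rewrite -cardE card_prod; congr (_ * _); rewrite -card_sets cardE.
(* For each start state and each target set there are [2 ^ S] chains of at most [S] conjunctions,
   and one disjunction tree over them. *)
apply: (@ext_leq _ _ (size (enum {: St * {set St}})
    * (size (enum {set St}) * S + (size (enum {set St})).-1))).
  rewrite card_idx card_sets.
  have := muln_succ_le_exp S; have := expn_gt0 2 S.
  by rewrite (_ : 3 * S = S + S + S) ?expnD; [nia|lia].
pose F p gs' := avail gs' (d + 2 * S) (reach i k p).
apply: (@ext_sub _ _ _ _ (fun gs' => forall p,
    p \in enum {: St * {set St}} -> F p gs') _ _ (leqnn _)); last first.
  by move=> gs' H p; apply: H; rewrite mem_enum.
apply: ext_all => [p g1 g2|[s A] g1 _]; first exact: avail_cat.
pose term B gs' := avail gs' (d + S) (fun x b =>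
  if b then reach i j (s, B) x b /\ forall q, q \in enum B -> reach j k (q, A) x b
  else reach i j (s, B) x b \/ exists2 q, q \in enum B & reach j k (q, A) x b).
apply: (ext_bind (ext_all (D := term) _ _)) => [B g2 g3|B g2 _|g2 Hterm].
- exact: avail_cat.
- have leB : size (enum B) <= S by rewrite -cardE max_card.
  apply: ext_sub (ext_and_chain (s := enum B) (P := fun q => reach j k (q, A))
    (avail_cat g2 (avail_cat g1 (Hij (s, B)))) _) (leB) _.
    by move=> q _; do 2!apply: avail_cat; apply: Hjk.
  by move=> gs' /avail_weaken; apply; rewrite leq_add2l.
have nonempty : enum {set St} != [::].
  by rewrite -size_eq0 card_sets -lt0n expn_gt0.
have le_sets : size (enum {set St}) <= 2 ^ S by rewrite card_sets.
apply: (ext_sub (ext_or_tree nonempty le_sets Hterm) (leqnn _)) => gs'.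
move/avail_sub; apply=> [|x b]; first by rewrite -/S; lia.
have def_ik : k - i = (j - i) + (k - j) by lia.
have def_j : i + (j - i) = j by lia.
rewrite /reach /= def_ik; case: b; split.
- case=> B _ [[r Hr rB] /(_ r)]; rewrite mem_enum rB => /(_ isT)[q Hq qA].
  by exists q => //; apply/steps_cat; exists r; rewrite ?def_j.
- case=> q /steps_cat[r Hr]; rewrite def_j => Hq qA.
  exists [set r]; first by rewrite mem_enum.
  split=> [|r']; first by exists r; rewrite ?set11.
  by rewrite mem_enum inE => /eqP->; exists q.
(* [B] collects the states from which [A] cannot be missed. If its term can be 0, the first block
   can end outside [B], at a state from which [A] can be missed. *)
- pose B := [set r |
    ~~ `[< exists2 q, steps (k - j) j x r q & (q \in A) = false >]].
  move/(_ B); rewrite mem_enum => /(_ isT)[[r Hr]|[r]].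
    rewrite inE => /negbFE/asboolP[q Hq qA].
    by exists q => //; apply/steps_cat; exists r; rewrite ?def_j.
  by rewrite mem_enum inE => /asboolP.
case=> q /steps_cat[r Hr]; rewrite def_j => Hq qA B _.
have [rB|rB] := boolP (r \in B); last by left; exists r => //; apply/negbTE.
by right; exists r; rewrite ?mem_enum //; exists q.
Qed.

Definition letter (y : seq bool) : Sigma := [tuple nth false y j | j < l].

Lemma letter_val (y : Sigma) : letter y = y.
Proof. by apply: eq_from_tnth => j; rewrite tnth_mktuple (tnth_nth false). Qed.

Lemma compat_letter x i (P : Sigma -> Prop) :
  (exists2 y : seq bool, compat x (wires l i) y & P (letter y)) <->
  (exists2 y : Sigma, compat x (wires l i) y & P y).
Proof.
split=> [[y Hy Py]|[y Hy Py]]; last by exists y => //; rewrite letter_val.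
have sz : size y == l by case/andP: Hy; rewrite size_iota.
by exists (Tuple sz) => //; rewrite -(letter_val (Tuple sz)).
Qed.

(** With [k = trunc_log 2 l], the shared functions of [k] wires cost at most [12 * 2 ^ l] because
    [2 ^ k <= l], while each tree has only [2 ^ (l - k)] leaves. The [|S| * 2 ^ |S|] trees number at
    most [2 ^ (2 * |S|)]. *)
Lemma ext_reach_letter gs i : 0 < l -> i < n -> ext (l * n) gs
  (12 * 2 ^ l + 6 * (2 ^ (2 * #|St|) * 2 ^ (l - trunc_log 2 l)))
  (reaches i i.+1 (1 + 4 * l)).
Proof.
move=> l_gt0 lt_i; set k := trunc_log 2 l; set S := #|St|.
have le_k : 2 ^ k <= l by apply: trunc_logP.
have k_le : k <= l by apply: leq_trans le_k; apply/ltnW/ltn_expl.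
have card_idx : size (enum {: St * {set St}}) = S * 2 ^ S.
  by rewrite -cardE card_prod -(cardsT {set St}) -powersetT card_powerset cardsT.
pose sel1 := iota (i * l) (l - k); pose sel2 := iota (i * l + (l - k)) k.
have sel_cat : sel1 ++ sel2 = wires l i by rewrite -iotaD subnK.
pose Phi p y := t p.1 (letter y) \in p.2.
have Hsel : all (gtn (l * n)) (sel1 ++ sel2) by rewrite sel_cat wires_lt.
apply: ext_sub (ext_functions (enum {: St * {set St}}) Phi Hsel) _ _.
  rewrite card_idx !size_iota; apply: leq_add.
    by rewrite leq_pmul2l // leq_exp2l.
  rewrite mulnCA leq_pmul2l // leq_pmul2r ?expn_gt0 //.
  by rewrite mul2n -addnn expnD leq_pmul2r ?expn_gt0 // ltnW // ltn_expl.
move=> gs' H p; have := H p; rewrite mem_enum => /(_ isT).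
rewrite sel_cat size_iota => /avail_sub; apply=> // x b.
have -> : reach i i.+1 p x b <->
    exists2 y : Sigma, compat x (wires l i) y & (t p.1 y \in p.2) = b.
  rewrite /reach subSnn /=.
  split=> [[q [y Hy <-] Hq]|[y Hy Hb]]; first by exists y.
  by exists (t p.1 y) => //; exists y.
exact: (@compat_letter x i (fun y => (t p.1 y \in p.2) = b)).
Qed.

Lemma ext_reach_prefixes gs s0 : 0 < l -> ext (l * n) gs
  (2 + (n * (12 * 2 ^ l + 6 * (2 ^ (2 * #|St|) * 2 ^ (l - trunc_log 2 l)))
    + 2 * n * (2 * 2 ^ (3 * #|St|))))
  (fun gs' => forall i A, i < n ->
    avail gs' (1 + 4 * l + 4 * #|St| * trunc_log 2 n) (reach 0 i (s0, A))).
Proof.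
move=> l_gt0.
(* The empty prefix ends in the start state, so its membership bits are constants. *)
have const0 : ext (l * n) gs 2
    (fun gs' => forall e,
      avail gs' 1 (fun (_ : (l * n).-tuple ternary) b => e = b)).
  apply: (@ext_leq _ _ (1 + 1)) => //.
  apply: (ext_bind (@ext_const _ _ true)) => g1 H1.
  apply: (ext_sub (@ext_const _ _ false)) => // gs' H0 [//|].
    exact: avail_cat.
  exact: H0.
apply: (ext_bind const0) => g1 H1; rewrite -[X in X * (12 * _ + _)](size_iota 0 n).
pose base i := reaches i i.+1 (1 + 4 * l).
apply: (ext_bind (ext_all (D := base) _ _)) => [i g2 g3 H p|i g2|g2 Hbase].
- exact/avail_cat/H.
- by rewrite mem_iota => lt_i; apply: ext_reach_letter.
apply: ext_sub (@ext_scan _ reaches _ (2 * #|St|) _ n (1 + 4 * l) _ _ _ _)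
  (leqnn _) _ => [i j d g3 g4 H p|i j d d' g3 le_d H p|i j k d g3|i lt_i|gs' H].
- exact/avail_cat/H.
- exact: avail_weaken (H p) le_d.
- exact: ext_reach_cat.
- by apply: Hbase; rewrite mem_iota.
case=> [|i] A lt_i.
  apply: avail_sub (avail_cat _ (avail_cat _ (H1 (s0 \in A)))) _ _ => [|x b].
    by rewrite -addnA leq_addr.
  by split=> [Hb|[q /= <-]] //; exists s0.
by apply: avail_weaken (H i (ltnW lt_i) (s0, A)) _; rewrite mulnA.
Qed.

(** One tree is built per position and per function in [phis], so output bits with equal functions
    share it; this is the source of the factor lambda. *)
Lemma ext_reach_outputs gs s0 (phis : seq {ffun St * Sigma -> bool}) : 0 < l ->
  ext (l * n) gs
  (2 + (n * (12 * 2 ^ l + 6 * (2 ^ (2 * #|St|) * 2 ^ (l - trunc_log 2 l)))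
    + 2 * n * (2 * 2 ^ (3 * #|St|))) + n * size phis * (6 * 2 ^ l))
  (fun gs' => forall i phi, i < n -> phi \in phis ->
    avail gs' (1 + 8 * l + 4 * #|St| * trunc_log 2 n) (fun x b =>
      exists q y, [/\ steps i 0 x s0 q, compat x (wires l i) (val y)
        & phi (q, y) = b])).
Proof.
move=> l_gt0; apply: (ext_bind (ext_reach_prefixes s0 l_gt0)) => g1 H1.
pose goal (k : nat * {ffun St * Sigma -> bool}) gs' :=
  avail gs' (1 + 8 * l + 4 * #|St| * trunc_log 2 n) (fun x b =>
    exists q y, [/\ steps k.1 0 x s0 q, compat x (wires l k.1) (val y)
      & k.2 (q, y) = b]).
have sz : size [seq (i, phi) | i <- iota 0 n, phi <- phis] = n * size phis.
  by rewrite size_allpairs size_iota.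
rewrite -sz; apply: (ext_sub (ext_all (D := goal) _ _) (leqnn _)); last first.
- move=> gs' H i phi lt_i Hphi; apply: (H (i, phi)).
  by apply/allpairsP; exists (i, phi); rewrite mem_iota.
- move=> k g2 /allpairsP[[i phi] [/= Hi Hphi ->]].
  have lt_i : i < n by move: Hi; rewrite mem_iota.
  pose G y := reach 0 i (s0, [set q | phi (q, letter y)]).
  have Hsel : all (gtn (l * n)) (wires l i) by rewrite wires_lt.
  apply: ext_sub
    (ext_tree (G := G) Hsel (fun y _ => avail_cat g2 (H1 i _ lt_i))) _ _.
    by rewrite size_iota.
  move=> gs'; rewrite size_iota => /avail_sub; apply=> [|x b]; first by lia.
  rewrite /= (@compat_letter x i
    (fun y => reach 0 i (s0, [set q | phi (q, y)]) x b)) /reach subn0.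
  split=> [[y Hy [q Hq]]|[q [y [Hq Hy Hb]]]].
    by rewrite inE => Hb; exists q, y.
  by exists y => //; exists q; rewrite ?inE.
by move=> k g2 g3; apply: avail_cat.
Qed.

(** The output at position [i] ignores later letters, so a run of [i] letters and one further letter
    extend to a resolution of the whole input. *)
Lemma steps_resolution x s0 (i : 'I_n) (Q : St -> Sigma -> Prop) :
  (exists q y, [/\ steps i 0 x s0 q, compat x (wires l i) (val y) & Q q y]) <->
  exists2 Y, Y \in resolution x &
    Q (foldl t s0 (take i (blocks Y))) (tnth (blocks Y) i).
Proof.
pose y0 : Sigma := [tuple of nseq l false].
split=> [[q [y [/steps_foldl[ys [sz <- Hys]] Hy HQ]]]
        |[Y /resolution_blocks HY HQ]].
  (* An arbitrary fixed resolution supplies the letters after position [i]. *)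
  pose dflt := blocks (map_tuple (odflt false) x).
  have /resolution_blocks Hdflt : map_tuple (odflt false) x \in resolution x.
    by apply/mem_resolution => p; rewrite tnth_map; case: (tnth x p) => [[]|].
  pose z := [tuple if r <= i then nth y0 (rcons ys y) r else tnth dflt r | r < n].
  have z_i : tnth z i = y by rewrite tnth_mktuple leqnn nth_rcons sz ltnn eqxx.
  have take_z : take i z = ys.
    have sz_z : size (take i z) = i by rewrite size_takel ?size_tuple // ltnW.
    apply: (@eq_from_nth _ y0) => [|r]; rewrite sz_z // => lt_r.
    have lt_rn := ltn_trans lt_r (ltn_ord i).
    rewrite nth_take // -(tnth_nth y0 z (Ordinal lt_rn)) tnth_mktuple /=.
    by rewrite ltnW // nth_rcons sz lt_r.
  exists (concat z); last by rewrite concatK take_z z_i.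
  apply/resolution_blocks => r; rewrite concatK tnth_mktuple.
  have [le_r|//] := leqP r i; rewrite nth_rcons sz.
  have [lt_r|le_ir] := ltnP r i; first exact: (Hys r).
  have -> : nat_of_ord r = i by apply/eqP; rewrite eqn_leq le_r.
  by rewrite eqxx.
exists (foldl t s0 (take i (blocks Y))), (tnth (blocks Y) i); split=> //.
apply/steps_foldl; exists (take i (blocks Y)); split=> // [|r lt_r].
  by rewrite size_takel ?size_tuple // ltnW.
have lt_rn := ltn_trans lt_r (ltn_ord i).
rewrite nth_take // -(tnth_nth _ (blocks Y) (Ordinal lt_rn)).
exact: (HY (Ordinal lt_rn)).
Qed.

End Reach.

(** * The circuit for the transcription function *)

Lemma hazard_free_transducer l m n (Lambda : {set m.-tuple bool})
    (T : mealy (l.-tuple bool) {y : m.-tuple bool | y \in Lambda}) :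
    0 < l -> 0 < m -> 0 < n ->
  let S := #|state T| in
  exists C : circuit (l * n) (m * n),
    [/\ hazard_free C (@transcription_bool l m Lambda T n),
        circuit_size C <= (4 * 2 ^ (3 * S)
          + 6 * (2 ^ (2 * S) * 2 ^ (l - trunc_log 2 l))
          + 20 * (2 ^ l * minn m (2 ^ (S * #|{: l.-tuple bool}|)))) * n
      & depth C <= 1 + 8 * l + 4 * S * trunc_log 2 n].
Proof.
move=> l_gt0 m_gt0 n_gt0 S; set lambda := minn _ _.
pose phi (j : 'I_m) := [ffun sy : state T * l.-tuple bool =>
  tnth (val (out sy.1 sy.2)) j].
(* Without duplicates, the length is bounded both by [m] and by the number of Boolean functions of a
   state and a letter. *)
pose phis := undup [seq phi j | j : 'I_m].
have mem_phis j : phi j \in phis by rewrite mem_undup map_f ?mem_enum.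
have size_phis : size phis <= lambda.
  rewrite leq_min; apply/andP; split.
    by rewrite (leq_trans (size_undup _)) // size_map size_enum_ord.
  rewrite -(card_uniqP (undup_uniq _)) (leq_trans (max_card _)) //.
  by rewrite card_ffun card_bool card_prod.
have lambda_gt0 : 0 < lambda by rewrite leq_min m_gt0 expn_gt0.
have [gs [/= top size_gs Hgs]] :=
  @ext_reach_outputs l n _ (@trans _ _ T) [::] (start T) phis l_gt0 isT.
have lt_i (p : 'I_(m * n)) : p %/ m < n by rewrite ltn_divLR // [n * m]mulnC.
have lt_j (p : 'I_(m * n)) : p %% m < m by rewrite ltn_mod.
have [C [def_gs depth_C HC]] := circuit_of_avail top
  (fun p => Hgs _ _ (lt_i p) (mem_phis (Ordinal (lt_j p)))).
have Htr p Y : tnth (@transcription_bool l m Lambda T n Y) p =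
    phi (Ordinal (lt_j p)) (foldl (@trans _ _ T) (start T)
      (take (Ordinal (lt_i p)) (blocks Y)), tnth (blocks Y) (Ordinal (lt_i p))).
  rewrite ffunE (tnth_nth false) [X in nth _ _ X](divn_eq p m).
  rewrite (tnth_concat _ (Ordinal (lt_i p)) (Ordinal (lt_j p))).
  by rewrite tnth_map tnth_mktuple.
exists C; split=> [x||].
- apply: eq_from_tnth => p; apply: can_inj => b.
  have HR := @steps_resolution l n _ (@trans _ _ T) x (start T)
    (Ordinal (lt_i p)) (fun q y => phi (Ordinal (lt_j p)) (q, y) = b).
  apply/idP/idP => [/HC/HR[Y HY Hb]|/can_hazard_free_extension[Y HY Hb]].
    by apply/can_hazard_free_extension; exists Y; rewrite ?Htr.
  by apply/HC/HR; exists Y; rewrite -?Htr.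
- rewrite /circuit_size def_gs (leq_trans size_gs) // -/S.
  have l2 := expn_gt0 2 l.
  (* As [lambda] and [n] are positive, the two constant gates and the tables of size [12 * 2 ^ l]
     join the output trees: [20 = 2 + 12 + 6]. *)
  have le_lam : 2 ^ l <= 2 ^ l * lambda by rewrite leq_pmulr.
  have le_phis : 2 ^ l * size phis <= 2 ^ l * lambda.
    by rewrite leq_mul2l size_phis orbT.
  move: (2 ^ l * lambda) le_lam le_phis => A le_lam le_phis.
  move: (2 ^ (3 * S)) (2 ^ (2 * S) * _) => B D.
  have -> : n * size phis * (6 * 2 ^ l) = 6 * n * (2 ^ l * size phis) by nia.
  move: (2 ^ l * size phis) le_phis => E le_phis; nia.
exact: depth_C.
Qed.

(** * Bounds over the reals *)

Local Open Scope ring_scope.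

Lemma trunc_log_le_log2 (R : realType) n : (0 < n)%N ->
  (trunc_log 2 n)%:R <= log2 (n%:R : R).
Proof.
move=> n_gt0; have ln2_gt0 : 0 < ln (2 : R) by rewrite ln_gt0 ?ltr1n.
rewrite /log2 ler_pdivlMr // mulr_natl -lnXn // ler_ln ?posrE ?exprn_gt0 ?ltr0n //.
by rewrite -natrX ler_nat trunc_logP.
Qed.

(** Rounding the logarithm down costs at most a factor 2, as [l < 2 ^ (trunc_log 2 l).+1]. *)
Lemma exp_sub_trunc_log_le (R : realType) l : (0 < l)%N ->
  (2 ^ (l - trunc_log 2 l))%N%:R <= 2 * (2 ^+ l / l%:R) :> R.
Proof.
move=> l_gt0; rewrite mulrA ler_pdivlMr ?ltr0n // -natrX -!natrM ler_nat.
have lt_l : (l < 2 ^ (trunc_log 2 l).+1)%N by rewrite trunc_log_ltn.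
have le_l : (trunc_log 2 l <= l)%N.
  have : (2 ^ trunc_log 2 l <= l)%N by apply: trunc_logP.
  by apply: leq_trans; apply/ltnW/ltn_expl.
apply: leq_trans (_ : 2 ^ (l - trunc_log 2 l) * 2 ^ (trunc_log 2 l).+1 <= _)%N.
  by rewrite leq_mul2l ltnW ?orbT.
by rewrite -expnD addnS subnK // expnS.
Qed.

Theorem corollary1p8 (R : realType) :
  exists c1 c2 : R,
    forall (l m n : nat) (l_gt0 : (0 < l)%N) (m_gt0 : (0 < m)%N)
      (n_gt0 : (0 < n)%N) (Lambda : {set m.-tuple bool})
      (T : mealy (l.-tuple bool) {y : m.-tuple bool | y \in Lambda}),
    let S := #|state T| in
    let lambda := minn m (2 ^ (S * #|{: l.-tuple bool}|)) in
    exists C : circuit (l * n) (m * n),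
      [/\ implements C (@transcription_bool l m Lambda T n),
          hazard_free C (@transcription_bool l m Lambda T n),
          (circuit_size C)%:R <=
            c1 * ((2 ^+ (3 * S) + 2 ^+ (2 * S + l) / l%:R
                   + 2 ^+ l * lambda%:R) * n%:R)
        & (depth C)%:R <= c2 * (S%:R * log2 n%:R + l%:R)].
Proof.
(* The size coefficients are 4, [6 * 2 = 12] and 20; for the depth, [1 + 8 * l <= 9 * l]. *)
exists 20, 9 => l m n l_gt0 m_gt0 n_gt0 Lambda T S lambda.
have [C [HC sizeC depthC]] := hazard_free_transducer T l_gt0 m_gt0 n_gt0.
exists C; split=> //; first exact: hazard_free_implements.
  move: sizeC; rewrite -(ler_nat R) => /le_trans; apply.
  rewrite natrM mulrA ler_pM2r ?ltr0n // !natrD !natrM !natrX -/S.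
  have le_l : 2 ^+ (2 * S) * 2 ^+ (l - trunc_log 2 l) <=
      2 * (2 ^+ (2 * S + l) / l%:R) :> R.
    rewrite exprD -mulrA [leRHS]mulrCA ler_pM2l ?exprn_gt0 //.
    by rewrite -natrX exp_sub_trunc_log_le.
  have S_ge0 : 0 <= 2 ^+ (3 * S) :> R by rewrite exprn_ge0.
  have l_ge0 : 0 <= 2 ^+ (2 * S + l) / l%:R :> R.
    by rewrite divr_ge0 ?exprn_ge0 ?ler0n.
  rewrite -/lambda; lra.
move: depthC; rewrite -(ler_nat R) => /le_trans; apply.
rewrite natrD natrD !natrM -/S.
have le_log := trunc_log_le_log2 R n_gt0.
have S_ge0 : 0 <= S%:R :> R by rewrite ler0n.
have log_ge0 : 0 <= (trunc_log 2 n)%:R :> R by rewrite ler0n.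
have le_Slog : S%:R * (trunc_log 2 n)%:R <= S%:R * log2 (n%:R : R).
  by rewrite ler_wpM2l.
have Slog_ge0 : 0 <= S%:R * (trunc_log 2 n)%:R :> R by rewrite mulr_ge0.
have l_ge1 : 1 <= l%:R :> R by rewrite ler1n.
lra.
Qed.
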